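(* Let $N\ge1$ and $D\ge N+1$ be integers, and let Alice and Bob share the two-qudit maximally entangled state $$|\Phi_{D,0}^{(2)}\rangle=\frac{1}{\sqrt D}\sum_{j=0}^{D-1}|j\rangle^{A'}\otimes|j\rangle^{B'}.$$ Then there is a strategy in which Alice acts only on $AA'$ and Bob acts only on $BB'$, with no communication, Alice outputting $x\in\{0,\dots,D-1\}$ and Bob outputting $y\in\{0,\dots,D-1\}$, that wins the clock game on $N$ time-bins with certainty: for every $n\in\{0,1,\dots,N\}$ and every $\phi\in[0,2\pi)$, when the input on $AB$ is $|\Psi_{\phi,n}\rangle$, with probability one the outputs satisfy $(x+y)\bmod D=n$, and the post-measurement state of $AB$ is $|\Psi_{\phi,n}\rangle\langle\Psi_{\phi,n}|$.
   Context: Systems $A$ (Alice) and $B$ (Bob) each have a Hilbert space with orthonormal basis $|0\rangle,|1\rangle,\dots,|N\rangle$, where $|0\rangle$ is the vacuum (no excitation in any time-bin) and $|n\rangle$, for $1\le n\le N$, is the state with one excitation in time-bin $n$ and no excitation in the other time-bins. For $n\in\{1,\dots,N\}$ and $\phi\in[0,2\pi)$, $$|\Psi_{\phi,n}\rangle^{AB}=\tfrac{1}{\sqrt2}\left(|n\rangle^A|0\rangle^B+e^{i\phi}|0\rangle^A|n\rangle^B\right),$$ and for $n=0$, $|\Psi_{\phi,0}\rangle^{AB}=|0\rangle^A|0\rangle^B$. Clock game: a referee, who alone knows $n\in\{0,\dots,N\}$ and $\phi$, sends $|\Psi_{\phi,n}\rangle$ to Alice and Bob. Using a shared ancilla state on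 $A'B'$ and local operations, without communicating, they return classical values $x$ (from Alice) and $y$ (from Bob) and the resulting state of $AB$. They win if $x+y$, reduced modulo $D$ (with $D=N+1$ in the standard form of the game), equals $n$, and the referee's projective measurement $\{|\Psi_{\phi,n}\rangle\langle\Psi_{\phi,n}|,\ \mathbb{1}-|\Psi_{\phi,n}\rangle\langle\Psi_{\phi,n}|\}$ on the returned state yields the first outcome. A strategy here is a pair of quantum instruments: completely positive maps $\{\mathcal{A}_x\}_{x=0}^{D-1}$ from operators on $AA'$ to operators on $A$ with $\sum_x\mathcal{A}_x$ trace-preserving, and $\{\mathcal{B}_y\}_{y=0}^{D-1}$ from operators on $BB'$ to operators on $B$ with $\sum_y\mathcal{B}_y$ trace-preserving. Outputs $(x,y)$ occur with probability $\mathrm{Tr}[(\mathcal{A}_x\otimes\mathcal{B}_y)(\Psi^{AB}\otimes\Phi^{A'B'})]$, where $\Psi^{AB}$ is the density operator of the referee's input and $\Phi^{A'B'}=|\Phi_{D,0}^{(2)}\rangle\langle\Phi_{D,0}^{(2)}|$, and the post-measurement state is $(\mathcal{A}_x\otimes\mathcal{B}_y)(\Psi^{AB}\otimes\Phi^{A'B'})$ normalized to unit trace. *)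

(* Defs.v *)
From HB Require Import structures.
From mathcomp Require Import all_boot all_order all_algebra.
From mathcomp Require Import reals trigo.
From mathcomp Require Import complex.
(* Not imported: the notation [^t] of mxtens clashes with that of sesquilinear. *)
From mathcomp Require mxtens.

Set Implicit Arguments.
Unset Strict Implicit.
Unset Printing Implicit Defensive.

Import Order.TTheory GRing.Theory Num.Theory Num.Def.
Local Open Scope ring_scope.
Local Open Scope sesquilinear_scope.

(* The basis vector (i, k) of a tensor product of spaces of dimensions m and n
   has index [mxtens_index (i, k) : 'I_(m * n)]. *)
Notation tensmx := mxtens.tensmx.
Notation mxtens_index := mxtens.mxtens_index.
Notation mxtens_unindex := mxtens.mxtens_unindex.
Notation "A *t B" := (tensmx A B)
  (at level 40, left associativity, format "A  *t  B") : ring_scope.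

Section Quantum.
Variable C : numClosedFieldType.

Definition ket n (i : 'I_n) : 'cV[C]_n := delta_mx i 0.

(* |v><v| *)
Definition density n (v : 'cV[C]_n) : 'M[C]_n := v *m v ^t*.

(* In a [numClosedFieldType], [0 <= z] entails that z is real, so that M is
   necessarily Hermitian. *)
Definition psdmx n (M : 'M[C]_n) : Prop :=
  forall u : 'cV[C]_n, 0 <= (u ^t* *m M *m u) 0 0.

(* F (x) G: the linear extension of X (x) Y |-> F X (x) G Y, computed by
   expanding M on the matrix units e_ij (x) e_kl; see [map_tens_tensmx]. *)
Definition map_tens m m' n n' (F : 'M[C]_m -> 'M[C]_m')
    (G : 'M[C]_n -> 'M[C]_n') (M : 'M[C]_(m * n)) : 'M[C]_(m' * n') :=
  \sum_(i < m) \sum_(j < m) \sum_(k < n) \sum_(l < n)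
    M (mxtens_index (i, k)) (mxtens_index (j, l)) *:
      (F (delta_mx i j) *t G (delta_mx k l)).

Lemma linear_delta_sum m n (F : {linear 'M[C]_m -> 'M[C]_n}) (X : 'M[C]_m) :
  F X = \sum_i \sum_j X i j *: F (delta_mx i j).
Proof.
rewrite {1}[X]matrix_sum_delta raddf_sum; apply: eq_bigr => i _.
by rewrite raddf_sum; apply: eq_bigr => j _; exact: linearZ_LR.
Qed.

Lemma map_tens_tensmx m m' n n' (F : {linear 'M[C]_m -> 'M[C]_m'})
    (G : {linear 'M[C]_n -> 'M[C]_n'}) (X : 'M[C]_m) (Y : 'M[C]_n) :
  map_tens F G (X *t Y) = F X *t G Y.
Proof.
rewrite (linear_delta_sum F) (linear_delta_sum G).
apply/matrixP => a b; rewrite [RHS]mxE !summxE mulr_suml.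
apply: eq_bigr => i _; rewrite !summxE mulr_suml.
apply: eq_bigr => j _; rewrite !summxE mulr_sumr.
apply: eq_bigr => k _; rewrite !summxE mulr_sumr.
by apply: eq_bigr => l _; rewrite mxtens.tensmxE !mxE mulrACA.
Qed.

Definition completely_positive m n (F : 'M[C]_m -> 'M[C]_n) : Prop :=
  forall k (M : 'M[C]_(k * m)), psdmx M -> psdmx (map_tens (@idfun 'M[C]_k) F M).

Record instrument (m n D : nat) := Instrument {
  branch :> 'I_D -> {linear 'M[C]_m -> 'M[C]_n};
  branch_cp : forall x, completely_positive (branch x);
  branch_trace : forall M : 'M[C]_m, \tr (\sum_x branch x M) = \tr M }.

(* (A A') (B B') -> (A B) (A' B') on basis indices *)
Definition swap_index a a' b b' (i : 'I_((a * a') * (b * b'))) :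
    'I_((a * b) * (a' * b')) :=
  let ik := mxtens_unindex (mxtens_unindex i).1 in
  let jl := mxtens_unindex (mxtens_unindex i).2 in
  mxtens_index (mxtens_index (ik.1, jl.1), mxtens_index (ik.2, jl.2)).

(* An operator on (A B) (A' B') seen as an operator on (A A') (B B'). *)
Definition swap_middle a a' b b' (M : 'M[C]_((a * b) * (a' * b'))) :
    'M[C]_((a * a') * (b * b')) :=
  mxsub (@swap_index a a' b b') (@swap_index a a' b b') M.

Lemma swap_middle_tensmx a a' b b' (X : 'M[C]_a) (Y : 'M[C]_b)
    (X' : 'M[C]_a') (Y' : 'M[C]_b') :
  swap_middle ((X *t Y) *t (X' *t Y')) = (X *t X') *t (Y *t Y').
Proof.
apply/matrixP => i j.
by rewrite !mxE !mxtens.mxtens_indexK /= mulrACA.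
Qed.

Definition max_entangled D : 'cV[C]_(D * D) :=
  (sqrtC D%:R)^-1 *: \sum_(j < D) (ket j *t ket j).

Record strategy (N D : nat) := Strategy {
  alice : instrument (N.+1 * D) N.+1 D;
  bob : instrument (N.+1 * D) N.+1 D }.

Section Run.
Variables (N D : nat) (S : strategy N D) (Psi : 'cV[C]_(N.+1 * N.+1)).

(* (A_x (x) B_y)(Psi (x) Phi), not normalized *)
Definition outcome (x y : 'I_D) : 'M[C]_(N.+1 * N.+1) :=
  map_tens (alice S x) (bob S y)
    (swap_middle (density Psi *t density (max_entangled D))).

Definition output_prob (x y : 'I_D) : C := \tr (outcome x y).

(* Meaningful only when [output_prob x y != 0]. *)
Definition post_state (x y : 'I_D) : 'M[C]_(N.+1 * N.+1) :=
  (output_prob x y)^-1 *: outcome x y.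

Definition correct (n : 'I_N.+1) (x y : 'I_D) : bool :=
  ((x + y) %% D == n)%N.

Definition correct_prob (n : 'I_N.+1) : C :=
  \sum_x \sum_(y | correct n x y) output_prob x y.

(* The answer is correct and the referee's measurement {|Psi><Psi|, 1 - |Psi><Psi|}
   of the returned state yields the first outcome. *)
Definition win_prob (n : 'I_N.+1) : C :=
  \sum_x \sum_(y | correct n x y) \tr (density Psi *m outcome x y).

End Run.
End Quantum.

Definition expi (R : realType) (phi : R) : R[i] := Complex (cos phi) (sin phi).

Definition clock_state (R : realType) (N : nat) (phi : R) (n : 'I_N.+1) :
    'cV[R[i]]_(N.+1 * N.+1) :=
  if n == ord0 then ket _ ord0 *t ket _ ord0
  else (sqrtC 2)^-1 *:
         (ket _ n *t ket _ ord0 + expi phi *: (ket _ ord0 *t ket _ n)).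

(* Main.v *)
Require Import Defs.
From mathcomp Require Import all_boot all_order all_algebra.
From mathcomp Require Import cyclic separable cyclotomic.
From mathcomp Require Import reals trigo.
From mathcomp Require Import complex.
From mathcomp Require Import ring.
From mathcomp Require mxtens.

(* With z a primitive D-th root of unity, each party applies the phase z^(a j),
   controlled by its time-bin a, to its half of the entangled pair. On the
   support of Psi_n the two bins sum to n, so this maps Phi to
   D^(-1/2) sum_j z^(n j) |jj> and leaves A B untouched. Measuring both halves
   in the Fourier basis f_x = D^(-1/2) sum_j z^(x j) |j> then has amplitude
   D^(-3/2) sum_j z^((n - x - y) j), which is D^(-1/2) if x + y = n mod D and 0
   otherwise, whatever phi is. *)

Set Implicit Arguments.
Unset Strict Implicit.
Unset Printing Implicit Defensive.

Import Order.TTheory GRing.Theory Num.Theory.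
Local Open Scope ring_scope.
Local Open Scope sesquilinear_scope.

(** * Kraus maps and the instruments built from them *)

Section Kraus.
Variable C : numClosedFieldType.

Lemma trmxCM m n p (A : 'M[C]_(m, n)) (B : 'M[C]_(n, p)) :
  (A *m B) ^t* = B ^t* *m A ^t*.
Proof. by rewrite trmx_mul map_mxM. Qed.

Lemma trmxC_tens m n p q (A : 'M[C]_(m, n)) (B : 'M[C]_(p, q)) :
  (A *t B) ^t* = A ^t* *t B ^t*.
Proof. by apply/matrixP => i j; rewrite !mxE rmorphM. Qed.

Lemma trmxC1 n : (1%:M : 'M[C]_n) ^t* = 1%:M.
Proof. by apply/matrixP => i j; rewrite !mxE conjC_nat eq_sym. Qed.

(** Composing library maps, rather than writing a lambda, lets the linear structure be inferred. *)
Definition kraus m n (K : 'M[C]_(n, m)) : {linear 'M[C]_m -> 'M[C]_n} :=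
  mulmxr (K ^t*) \o mulmx K.

Lemma krausE m n (K : 'M[C]_(n, m)) M : kraus K M = K *m M *m K ^t*.
Proof. by []. Qed.

Lemma kraus1 n (M : 'M[C]_n) : kraus 1%:M M = M.
Proof. by rewrite krausE trmxC1 mulmx1 mul1mx. Qed.

Lemma tens_delta_mx m n (i j : 'I_m) (k l : 'I_n) :
  delta_mx i j *t delta_mx k l
    = delta_mx (mxtens_index (i, k)) (mxtens_index (j, l)) :> 'M[C]_(m * n).
Proof.
apply/matrixP => a b.
have [i' k'] := mxtens.mxtens_indexP a; have [j' l'] := mxtens.mxtens_indexP b.
rewrite mxtens.tensmxE !mxE !(can_eq (@mxtens.mxtens_indexK _ _)) !xpair_eqE.
by rewrite -natrM mulnb andbACA.
Qed.

Lemma big_mxtens (V : nmodType) m n (F : 'I_(m * n) -> V) :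
  \sum_i F i = \sum_i \sum_j F (mxtens_index (i, j)).
Proof.
rewrite pair_big (reindex (@mxtens_index m n)) /=; last first.
  by exists (@mxtens_unindex m n) => i _;
    rewrite (mxtens.mxtens_indexK, mxtens.mxtens_unindexK).
by apply: eq_bigr => -[].
Qed.

(** This expansion on matrix units lets [map_tens_kraus] pass from product operators to arbitrary,
    possibly entangled ones. *)
Lemma map_tens_id m n (M : 'M[C]_(m * n)) :
  map_tens (fun X : 'M[C]_m => X) (fun Y : 'M[C]_n => Y) M = M.
Proof.
rewrite /map_tens [RHS]matrix_sum_delta big_mxtens; apply: eq_bigr => i _.
rewrite [LHS]exchange_big; apply: eq_bigr => k _.
rewrite big_mxtens; apply: eq_bigr => j _; apply: eq_bigr => l _.
by rewrite tens_delta_mx.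
Qed.

Lemma map_tens_kraus m m' n n' (K : 'M[C]_(m', m)) (L : 'M[C]_(n', n)) M :
  map_tens (kraus K) (kraus L) M = kraus (K *t L) M.
Proof.
rewrite -{2}[M]map_tens_id /map_tens.
do 4!(rewrite raddf_sum; apply: eq_bigr => ? _).
by rewrite [RHS]linearZ !krausE trmxC_tens !mxtens.tensmx_mul.
Qed.

Lemma kraus_psdmx m n (K : 'M[C]_(n, m)) M : psdmx M -> psdmx (kraus K M).
Proof.
move=> M_ge0 u; have := M_ge0 (K ^t* *m u).
by rewrite trmxCM trmxCK krausE !mulmxA.
Qed.

Lemma kraus_density m n (K : 'M[C]_(n, m)) (v : 'cV[C]_m) :
  kraus K (density v) = density (K *m v).
Proof. by rewrite krausE /density trmxCM !mulmxA. Qed.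

(** Adjoining a reference system turns conjugation by [K] into conjugation by [1%:M *t K], and
    conjugation preserves positivity. *)
Lemma kraus_cp m n (K : 'M[C]_(n, m)) : completely_positive (kraus K).
Proof.
move=> k M M_ge0.
have -> : map_tens (@idfun 'M[C]_k) (kraus K) M = kraus (1%:M *t K) M.
  rewrite -map_tens_kraus; do 4!(apply: eq_bigr => ? _).
  by rewrite [kraus 1%:M _]kraus1.
exact: kraus_psdmx.
Qed.

Section Instrument.
Variables (m n D : nat) (K : 'I_D -> 'M[C]_(n, m)).
Hypothesis K_complete : \sum_x (K x) ^t* *m K x = 1%:M.

Lemma kraus_trace (M : 'M[C]_m) : \tr (\sum_x kraus (K x) M) = \tr M.
Proof.
rewrite -[in RHS](mul1mx M) -K_complete mulmx_suml !raddf_sum /=.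
by apply: eq_bigr => x _; rewrite [LHS]mxtrace_mulC mulmxA.
Qed.

Definition kraus_instrument : instrument C m n D :=
  Instrument (fun x => kraus_cp (K x)) kraus_trace.

End Instrument.

(** * Pure states *)

Lemma density_scale n (c : C) (v : 'cV[C]_n) :
  density (c *: v) = (c * c^*) *: density v.
Proof.
apply/matrixP => i j.
by rewrite !mxE !big_ord1 !mxE rmorphM mulrACA.
Qed.

Lemma trace_density n (v : 'cV[C]_n) : \tr (density v) = (v ^t* *m v) 0 0.
Proof. by rewrite /density mxtrace_mulC [LHS]big_ord1. Qed.

Lemma mul_density n (v : 'cV[C]_n) :
  density v *m density v = (v ^t* *m v) 0 0 *: density v.
Proof.
rewrite /density !mulmxA -(mulmxA v) {1}[v ^t* *m v]mx11_scalar.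
by rewrite mul_mx_scalar scalemxAl.
Qed.

(** Reordering tensor factors keeps a pure state pure, so a whole run can be computed on vectors. *)
Lemma swap_middle_density a a' b b' (v : 'cV[C]_(a * b)) (w : 'cV[C]_(a' * b')) :
  swap_middle (density v *t density w)
    = density (rowsub (@swap_index a a' b b') (v *t w)).
Proof.
apply/matrixP => i j; rewrite !mxE !big_ord1 !mxE rmorphM.
(* The column index of a tensor product of column vectors has both components equal to 0. *)
by rewrite !(ord1 (mxtens_unindex _).1) !(ord1 (mxtens_unindex _).2) mulrACA.
Qed.

Lemma rowsub_swap_index a a' b b' (v : 'cV[C]_(a * b)) (w : 'cV[C]_(a' * b'))
    i j k l :
  rowsub (@swap_index a a' b b') (v *t w)
    (mxtens_index (mxtens_index (i, j), mxtens_index (k, l))) 0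
  = v (mxtens_index (i, k)) 0 * w (mxtens_index (j, l)) 0.
Proof.
by rewrite !mxE /swap_index !mxtens.mxtens_indexK /= !(ord1 (Ordinal _)).
Qed.

(** * Roots of unity and their orthogonality *)

(** In characteristic 0 the polynomial X^D - 1 is separable, so it has D distinct roots in C; D
    distinct D-th roots of unity include a primitive one. *)
Lemma prim_root_exists D : (0 < D)%N -> exists z : C, D.-primitive_root z.
Proof.
move=> D_gt0; pose p : {poly C} := 'X^D - 1.
have [r Dp] := closed_field_poly_normal p.
rewrite (monicP _) ?monicXnsubC // scale1r in Dp.
have rn1 : all D.-unity_root r by apply/allP=> z; rewrite -root_prod_XsubC -Dp.
have sz_r : (D < (size r).+1)%N.
  by rewrite -(size_prod_XsubC r id) -Dp size_XnsubC.
have [|z] := hasP (has_prim_root D_gt0 rn1 _ sz_r); last by exists z.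
by rewrite -separable_prod_XsubC -Dp separable_Xn_sub_1 // pnatr_eq0 -lt0n.
Qed.

Lemma prim_root_expr_neq0 D (z : C) k :
  (0 < D)%N -> D.-primitive_root z -> z ^+ k != 0.
Proof.
by move=> D_gt0 zD; rewrite expf_eq0 (prim_root_eq0 zD) eqn0Ngt D_gt0 andbF.
Qed.

(** From |z|^D = 1 and |z| >= 0 follows |z| = 1, and on the unit circle conjugation is inversion. *)
Lemma prim_root_conj D (z : C) k :
  (0 < D)%N -> D.-primitive_root z -> (z ^+ k)^* = (z ^+ k)^-1.
Proof.
move=> D_gt0 /prim_expr_order zD1.
have /eqP : `|z| ^+ D = 1 by rewrite -normrX zD1 normr1.
rewrite pexpr_eq1 // => /eqP z1.
by rewrite invC_norm normrX z1 !expr1n invr1 mul1r.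
Qed.

(** The sum is geometric with ratio u = z^(a - b), a D-th root of unity. If u is not 1, then (u - 1)
    times the sum is u^D - 1 = 0. *)
Lemma sum_prim_root D (z : C) a b : (0 < D)%N -> D.-primitive_root z ->
  \sum_(j < D) z ^+ (a * j) * (z ^+ (b * j))^*
    = if (a == b %[mod D])%N then D%:R else 0.
Proof.
move=> D_gt0 zD; pose u := z ^+ a * (z ^+ b)^*.
have zU k : z ^+ k \is a GRing.unit.
  by rewrite unitfE (prim_root_expr_neq0 _ D_gt0 zD).
transitivity (\sum_(j < D) u ^+ j).
  by apply: eq_bigr => j _; rewrite !exprM exprMn -rmorphXn.
have uE : (u == 1) = (a == b %[mod D])%N.
  rewrite -(eq_prim_root_expr zD) /u (prim_root_conj _ D_gt0 zD).
  by rewrite -(inj_eq (mulIr (zU b))) mulrVK // mul1r.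
rewrite -uE; case: eqP => [-> | /eqP u_neq1].
  by under eq_bigr do rewrite expr1n; rewrite sumr_const card_ord.
have uD : u ^+ D = 1.
  rewrite exprMn -rmorphXn -!exprM !(mulnC _ D) !exprM (prim_expr_order zD).
  by rewrite !expr1n rmorph1 mulr1.
apply/eqP; rewrite -(inj_eq (@mulfI _ (u - 1) _)) ?subr_eq0 //.
by rewrite -subrX1 uD subrr mulr0.
Qed.

(** * The Kraus operators of the strategy and their joint action *)

(* (1 (x) <f_x|) (sum_a |a><a| (x) Z^a), where Z = diag (z^j). *)
Definition phase_kraus m D (z : C) (x : 'I_D) : 'M[C]_(m, m * D) :=
  \matrix_(a, i) let bj := mxtens_unindex i in
    (a == bj.1)%:R * ((sqrtC D%:R)^-1 * (z ^+ (a * bj.2) * (z ^+ (x * bj.2))^*)).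

Lemma phase_krausE m D (z : C) (x j : 'I_D) (a b : 'I_m) :
  phase_kraus m z x a (mxtens_index (b, j)) =
  (a == b)%:R * ((sqrtC D%:R)^-1 * (z ^+ (a * j) * (z ^+ (x * j))^*)).
Proof. by rewrite mxE mxtens.mxtens_indexK. Qed.

Lemma sqrtCn_conj D : ((sqrtC D%:R)^-1)^* = (sqrtC D%:R)^-1 :> C.
Proof. by apply: CrealP; rewrite realV sqrtC_real // ler0n. Qed.

Lemma sqrtCn_sqr D : (sqrtC D%:R)^-1 * (sqrtC D%:R)^-1 = D%:R^-1 :> C.
Proof. by rewrite -invfM -expr2 sqrtCK. Qed.

(** A unitary is followed by a measurement in an orthonormal basis. In coordinates, the Kraus
    operators preserve the time-bin, which gives b = b', and summing over x gives j = j' by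
    orthogonality. *)
Lemma phase_kraus_complete m D (z : C) : (0 < D)%N -> D.-primitive_root z ->
  \sum_(x < D) (phase_kraus m z x) ^t* *m phase_kraus m z x = 1%:M.
Proof.
move=> D_gt0 zD; apply/matrixP => i i'.
have [b j] := mxtens.mxtens_indexP i; have [b' j'] := mxtens.mxtens_indexP i'.
rewrite summxE.
transitivity (\sum_(x < D) (b == b')%:R * (z ^+ (b * j))^* * z ^+ (b * j')
    * (D%:R^-1 * (z ^+ (j * x) * (z ^+ (j' * x))^*))).
  (* Only the intermediate time-bin equal to b contributes. *)
  apply: eq_bigr => x _; rewrite !mxE (bigD1 b) //= big1 => [|a neq_ab].
    rewrite addr0 !mxE !mxtens.mxtens_indexK /= eqxx mul1r.
    rewrite !rmorphM /= conjCK sqrtCn_conj -sqrtCn_sqr !(mulnC j) !(mulnC j').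
    by ring.
  by rewrite !mxE !mxtens.mxtens_indexK /= (negbTE neq_ab) mul0r rmorph0 mul0r.
rewrite -mulr_sumr -mulr_sumr (sum_prim_root _ _ D_gt0 zD) !modn_small // mxE.
rewrite (can_eq (@mxtens.mxtens_indexK _ _)) !xpair_eqE.
have D_neq0 : D%:R != 0 :> C by rewrite pnatr_eq0 -lt0n.
case: (b =P b') => [_|_]; last by rewrite !mul0r.
rewrite -(val_eqE j j') /=; case: (_ =P _) => [<-|_]; last by rewrite !mulr0.
rewrite (prim_root_conj _ D_gt0 zD) !mul1r.
by rewrite mulVf ?mulVf ?mulr1 ?(prim_root_expr_neq0 _ D_gt0 zD).
Qed.

Lemma max_entangledE D (j k : 'I_D) :
  max_entangled C D (mxtens_index (j, k)) 0 = (sqrtC D%:R)^-1 * (j == k)%:R.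
Proof.
rewrite mxE summxE (bigD1 j) //= big1 => [|i /negPf neq_ij].
  rewrite addr0 !mxE !mxtens.mxtens_indexK /= !(ord1 (Ordinal _)).
  by rewrite !eqxx !andbT mul1r eq_sym.
by rewrite !mxE !mxtens.mxtens_indexK /= eq_sym neq_ij mul0r.
Qed.

(** The factor depends on the bins only through a + b. Hence the joint Kraus operator acts as a
    scalar on any vector supported where a + b is constant, and coherence between such bins
    survives. *)
Lemma phase_kraus_apply m n D (z : C) (x y : 'I_D) (v : 'cV[C]_(m * n)) a b :
  (0 < D)%N -> D.-primitive_root z ->
  ((phase_kraus m z x *t phase_kraus n z y) *m
     rowsub (@swap_index m D n D) (v *t max_entangled C D)) (mxtens_index (a, b)) 0
  = (if (a + b == x + y %[mod D])%N then (sqrtC D%:R)^-1 else 0)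
      * v (mxtens_index (a, b)) 0.
Proof.
move=> D_gt0 zD; rewrite mxE.
(* D^(-3/2) collects one D^(-1/2) from each Kraus operator and one from the entangled state; it is
   split so that D^(-1) cancels the value D of the Fourier sum. *)
pose G j := (sqrtC D%:R)^-1 * D%:R^-1 * v (mxtens_index (a, b)) 0
   * (z ^+ ((a + b) * j) * (z ^+ ((x + y) * j))^*).
(* The Kraus operators force i = a and k = b, the entangled state forces l = j; a single sum over j
   remains. *)
transitivity (\sum_(i < m) \sum_(j < D) \sum_(k < n) \sum_(l < D)
   (if (i == a) && ((k == b) && (l == j)) then G j else 0)).
  rewrite !big_mxtens; apply: eq_bigr => i _; apply: eq_bigr => j _.
  rewrite big_mxtens; apply: eq_bigr => k _; apply: eq_bigr => l _.
  rewrite mxtens.tensmxE !phase_krausE rowsub_swap_index max_entangledE.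
  rewrite (eq_sym a) (eq_sym b) (eq_sym j).
  case: eqP => [-> | _]; last by rewrite !mul0r.
  case: eqP => [-> | _]; last by rewrite mul0r mulr0 mul0r.
  case: eqP => [-> | _]; last by rewrite !mulr0.
  rewrite /G -sqrtCn_sqr !mulnDl !exprD rmorphM /=; ring.
rewrite (bigD1 a) //= [X in _ + X]big1 => [|i /negPf neq_ia]; last first.
  by rewrite neq_ia; do 3!(rewrite big1 // => ? _).
rewrite eqxx addr0; transitivity (\sum_(j < D) G j).
  apply: eq_bigr => j _; rewrite (bigD1 b) //=.
  rewrite [X in _ + X]big1 => [|k /negPf neq_kb].
    by rewrite eqxx addr0 /= -big_mkcond big_pred1_eq.
  by rewrite neq_kb big1.
rewrite -mulr_sumr (sum_prim_root _ _ D_gt0 zD).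
case: ifP => _; last by rewrite mulr0 mul0r.
have D_neq0 : D%:R != 0 :> C by rewrite pnatr_eq0 -lt0n.
by rewrite mulrAC mulrVK // unitfE.
Qed.

(** * The strategy and its winning probability *)

Section FourierStrategy.
Variables (N D : nat) (z : C).
Hypotheses (D_gt0 : (0 < D)%N) (zD : D.-primitive_root z).

Definition fourier_strategy : strategy C N D :=
  let I := kraus_instrument (phase_kraus_complete N.+1 D_gt0 zD) in Strategy I I.

(** On the support of [Psi] the bins sum to n, so all components acquire the same factor, D^(-1/2)
    or 0, and the density acquires its squared modulus. *)
Lemma fourier_outcome (Psi : 'cV[C]_(N.+1 * N.+1)) (n : 'I_N.+1) x y :
  (n < D)%N ->
  (forall a b, Psi (mxtens_index (a, b)) 0 != 0 -> (a + b = n)%N) ->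
  outcome fourier_strategy Psi x y =
    (if correct n x y then D%:R^-1 else 0) *: density Psi.
Proof.
move=> lt_nD suppPsi.
rewrite /outcome swap_middle_density [LHS]map_tens_kraus kraus_density.
have -> : (phase_kraus N.+1 z x *t phase_kraus N.+1 z y) *m
     rowsub (@swap_index N.+1 D N.+1 D) (Psi *t max_entangled C D)
  = (if correct n x y then (sqrtC D%:R)^-1 else 0) *: Psi.
  apply/matrixP => i j; rewrite (ord1 j).
  have [a b] := mxtens.mxtens_indexP i.
  rewrite [LHS](phase_kraus_apply x y Psi a b D_gt0 zD) [RHS]mxE.
  have [-> | /suppPsi ->] := eqVneq (Psi (mxtens_index (a, b)) 0) 0.
    by rewrite !mulr0.
  (* Since n < D, congruence to n modulo D is the same as having remainder n. *)
  by rewrite /correct (modn_small lt_nD) eq_sym.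
rewrite density_scale; congr (_ *: _); case: ifP => _.
  by rewrite sqrtCn_conj sqrtCn_sqr.
by rewrite mul0r.
Qed.

End FourierStrategy.

(** Each x is completed by exactly one correct y. With c = 1/D the total is 1. *)
Lemma sum_correct N D (n : 'I_N.+1) (c : C) : (n < D)%N ->
  \sum_(x < D) \sum_(y < D | correct n x y) c = D%:R * c.
Proof.
move=> lt_nD; have D_gt0 : (0 < D)%N by apply: leq_trans lt_nD.
transitivity (\sum_(x < D) c); last by rewrite sumr_const card_ord mulr_natl.
apply: eq_bigr => x _.
(* This is n - x modulo D; adding D first avoids truncated subtraction. *)
pose y0 := Ordinal (ltn_pmod (n + (D - x)) D_gt0).
rewrite (big_pred1 y0) // => y /=; rewrite /correct -val_eqE /=.
have xy0 : (x + (n + (D - x)) = n %[mod D])%N.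
  by rewrite addnCA subnKC ?modnDr // ltnW.
by rewrite -{1}(modn_small lt_nD) -xy0 eqn_modDl (modn_small (ltn_ord y)).
Qed.

Lemma fourier_wins N D (z : C) (D_gt0 : (0 < D)%N) (zD : D.-primitive_root z)
    (Psi : 'cV[C]_(N.+1 * N.+1)) (n : 'I_N.+1)
    (S := fourier_strategy N D_gt0 zD) :
  (n < D)%N ->
  (forall a b, Psi (mxtens_index (a, b)) 0 != 0 -> (a + b = n)%N) ->
  (Psi ^t* *m Psi) 0 0 = 1 ->
  [/\ win_prob S Psi n = 1, correct_prob S Psi n = 1 &
      forall x y, output_prob S Psi x y != 0 ->
        post_state S Psi x y = density Psi].
Proof.
move=> lt_nD suppPsi normPsi.
have outE := fourier_outcome D_gt0 zD _ _ lt_nD suppPsi.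
have D_neq0 : D%:R != 0 :> C by rewrite pnatr_eq0 -lt0n.
have probE x y : output_prob S Psi x y = if correct n x y then D%:R^-1 else 0.
  by rewrite /output_prob outE mxtraceZ trace_density normPsi mulr1.
split=> [||x y].
- rewrite -(mulfV D_neq0) -(sum_correct _ lt_nD).
  apply: eq_bigr => x _; apply: eq_bigr => y xy.
  rewrite outE xy -scalemxAr mxtraceZ mul_density mxtraceZ trace_density.
  by rewrite normPsi !mulr1.
- rewrite -(mulfV D_neq0) -(sum_correct _ lt_nD).
  by apply: eq_bigr => x _; apply: eq_bigr => y xy; rewrite probE xy.
(* Incorrect pairs have probability 0 and are excluded; for correct ones the normalization cancels
   1/D. *)
rewrite /post_state probE outE; case: ifP => _; last by rewrite eqxx.
by move=> DV_neq0; rewrite scalerA mulVf // scale1r.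
Qed.

(** * Basis vectors, and the support and norm of the clock states *)

Lemma tens_ket m n (a : 'I_m) (b : 'I_n) :
  ket C a *t ket C b = ket C (mxtens_index (a, b)) :> 'cV_(m * n).
Proof.
apply/matrixP => i j; rewrite [in RHS](ord1 j).
have [a' b'] := mxtens.mxtens_indexP i.
rewrite !mxE !mxtens.mxtens_indexK /= !(ord1 (Ordinal _)) !eqxx !andbT.
by rewrite (can_eq (@mxtens.mxtens_indexK _ _)) xpair_eqE -natrM mulnb.
Qed.

Lemma ket_dot n (i j : 'I_n) : (ket C i) ^t* *m ket C j = (i == j)%:R%:M.
Proof.
rewrite trmx_delta map_delta_mx mul_delta_mx_cond; apply/matrixP => k l.
by rewrite !ord1 mulrb !mxE; case: eqP; rewrite !mxE.
Qed.

(** The cross terms vanish by orthogonality, and the two remaining terms add up to 2, which the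
    prefactor 1/2 cancels. *)
Lemma superposition_norm n (p q : 'I_n) (e : C)
    (v := (sqrtC 2)^-1 *: (ket C p + e *: ket C q)) :
  p != q -> e^* * e = 1 -> (v ^t* *m v) 0 0 = 1.
Proof.
move=> /negPf pq e1; have qp : (q == p) = false by rewrite eq_sym.
have -> : v ^t* = (sqrtC 2)^-1 *: ((ket C p) ^t* + e^* *: (ket C q) ^t*).
  by apply/matrixP => i j; rewrite !mxE !rmorphM rmorphD rmorphM /= sqrtCn_conj.
rewrite -scalemxAl -scalemxAr mulmxDl !mulmxDr -!scalemxAl -!scalemxAr.
rewrite !ket_dot !eqxx pq qp !mxE /= !mulr1n.
rewrite !mulr0 !addr0 !add0r mulr1 e1.
by rewrite mulrA sqrtCn_sqr mulVf // pnatr_eq0.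
Qed.

End Kraus.

Section Clock.
Variables (R : realType) (N : nat).
Local Notation C := R[i].

(** Only (n, 0) and (0, n) occur, or (0, 0) when n = 0. The relative phase does not affect the
    support. *)
Lemma clock_state_supp phi (n a b : 'I_N.+1) :
  clock_state phi n (mxtens_index (a, b)) 0 != 0 :> C -> (a + b = n)%N.
Proof.
rewrite /clock_state !tens_ket; case: (eqVneq n ord0) => [-> | /negPf n0].
  rewrite mxE (can_eq (@mxtens.mxtens_indexK _ _)) xpair_eqE.
  have [-> | _] := eqVneq a; have [-> | _] := eqVneq b => //=; rewrite eqxx //.
rewrite !mxE !(can_eq (@mxtens.mxtens_indexK _ _)) !xpair_eqE !andbT.
have [-> | _] := eqVneq a n.
  have [-> | _] := eqVneq b ord0; first by rewrite addn0.
  by rewrite n0 mulr0 addr0 mulr0 eqxx.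
have [-> | _] := eqVneq a ord0; last by rewrite mulr0 addr0 mulr0 eqxx.
have [-> // | _] := eqVneq b n.
by rewrite mulr0 addr0 mulr0 eqxx.
Qed.

Lemma expi_conj (phi : R) : (expi phi)^* * expi phi = 1.
Proof.
(* Conjugation on [R[i]] computes to negation of the imaginary part. *)
rewrite -[_^*]/(Complex (cos phi) (- sin phi)); apply/eqP.
rewrite eq_complex /= mulNr opprK -!expr2 cos2Dsin2 eqxx /=.
by rewrite mulNr (mulrC (cos phi)) subrr.
Qed.

Lemma clock_state_norm phi (n : 'I_N.+1) :
  ((clock_state phi n : 'cV[C]_(N.+1 * N.+1)) ^t* *m clock_state phi n) 0 0 = 1.
Proof.
rewrite /clock_state !tens_ket; case: (n =P ord0) => [_ | /eqP n_neq0].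
  by rewrite ket_dot eqxx mxE.
apply: superposition_norm; last exact: expi_conj.
(* The index pairs (n, 0) and (0, n) differ because n is not 0. *)
by rewrite (can_eq (@mxtens.mxtens_indexK _ _)) xpair_eqE (negPf n_neq0).
Qed.

End Clock.

Theorem mainTheorem3 (R : realType) (N D : nat)
    (hN : (1 <= N)%N) (hD : (N.+1 <= D)%N) :
  exists S : strategy R[i] N D,
    forall (n : 'I_N.+1) (phi : R), 0 <= phi < 2 * pi ->
      let Psi := clock_state phi n in
      [/\ win_prob S Psi n = 1,
          correct_prob S Psi n = 1 &
          forall x y : 'I_D, output_prob S Psi x y != 0 ->
            post_state S Psi x y = density Psi].
Proof.
have D_gt0 : (0 < D)%N by apply: leq_trans hD.
have [z zD] := prim_root_exists R[i] D_gt0.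
exists (fourier_strategy N D_gt0 zD) => n phi _ Psi.
apply: fourier_wins.
- exact: leq_trans (ltn_ord n) hD.
- exact: clock_state_supp.
- exact: clock_state_norm.
Qed.
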